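(* Let $\mathcal{P}_4$ be the set of partitions $\lambda=(\lambda_1>\cdots>\lambda_\ell)$ into distinct positive parts such that for each $1\le i<\ell$: $\lambda_i-\lambda_{i+1}\equiv2\pmod 4$ if both are odd; $\equiv0\pmod 4$ if both are even; $\equiv3\pmod 4$ if they have different parity; and the smallest part $\lambda_\ell\equiv1$ or $2\pmod 4$ (empty partition included). Then $$\sum_{\lambda\in\mathcal{P}_4}(-1)^{o(\lambda)}q^{|\lambda|}=\sum_{n=0}^{\infty}\frac{(q;q^2)_{n}(-1)^nq^{n^{2}}}{(q^4;q^4)_{n}}=\frac{(q;q^6)_{\infty}(q^5;q^6)_{\infty}(q^6;q^{12})_{\infty}^{2}}{(q^2;q^6)_{\infty}(q^3;q^6)_{\infty}(q^4;q^6)_{\infty}}.$$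
   Context: $o(\lambda)$ is the number of odd parts of $\lambda$, $|\lambda|$ the sum of its parts, $(a;q)_n=\prod_{i=0}^{n-1}(1-aq^i)$ for $n\in\mathbb{Z}_{\ge0}\cup\{\infty\}$, $|q|<1$. *)

(* Defs.v *)
From HB Require Import structures.
From mathcomp Require Import all_boot all_order all_algebra finmap.
From mathcomp Require Import complex.
From mathcomp Require Import all_classical all_reals all_analysis.
From mathcomp Require Import summability.

Set Implicit Arguments.
Unset Strict Implicit.
Unset Printing Implicit Defensive.

Import Order.TTheory GRing.Theory Num.Theory.
Import numFieldNormedType.Exports.

Local Open Scope classical_set_scope.
Local Open Scope ring_scope.

(* Partitions are lists of parts in decreasing order, lambda_1 first.  In the
   gap relation, [a - b] is truncated subtraction, harmless because [P4] also
   requires the list to be strictly decreasing. *)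
Definition P4_gap (a b : nat) : bool :=
  match odd a, odd b with
  | true, true => (a - b == 2 %[mod 4])%N
  | false, false => (a - b == 0 %[mod 4])%N
  | _, _ => (a - b == 3 %[mod 4])%N
  end.

Definition distinct_partition (s : seq nat) : bool :=
  sorted gtn s && all (fun a => 0 < a)%N s.

Definition P4 (s : seq nat) : bool :=
  [&& distinct_partition s, sorted P4_gap s
    & (s == [::]) || ((last 0 s == 1 %[mod 4])%N || (last 0 s == 2 %[mod 4])%N)].

Definition odd_parts (s : seq nat) : nat := count odd s.

Section QPochhammer.
Variable K : numFieldType.

Definition qpoch (a q : K) (n : nat) : K := \prod_(i < n) (1 - a * q ^+ i).

Definition qpoch_inf (a q : K) : K := limn (qpoch a q).

Definition P4_term (q : K) (s : {s : seq nat | P4 s}) : K :=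
  (-1) ^+ odd_parts (val s) * q ^+ sumn (val s).

Definition series_term (q : K) (n : nat) : K :=
  qpoch q (q ^+ 2) n * (-1) ^+ n * q ^+ (n ^ 2) / qpoch (q ^+ 4) (q ^+ 4) n.

End QPochhammer.

(* Main.v *)
Require Import Defs.
From mathcomp Require Import all_boot all_order all_algebra finmap complex.
From mathcomp Require Import all_classical all_reals all_analysis summability.
From mathcomp Require Import ring lra zify.

Set Implicit Arguments.
Unset Strict Implicit.
Unset Printing Implicit Defensive.

Import Order.TTheory GRing.Theory Num.Theory.
Import numFieldNormedType.Exports.
Local Open Scope classical_set_scope.
Local Open Scope ring_scope.

(* Combinatorial side: give an odd part residue 1 and an even part residue 2.
   The rules of P_4 say exactly that consecutive parts, and the last part seen
   against an empty residue 0, differ by the sum of their residues plus 4 k with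
   k >= 0.  A partition in P_4 is thus a free word of pairs (parity, k), and the
   i-th pair, counted from the largest part, contributes the factor
   (- q^(2i-1) + q^(2(2i-1))) / (1 - q^(4i)) to the generating function; the
   product over i <= n is the n-th term of the series.

   Product side (Slater's identity (25) with q replaced by -q): 1 / (q^4; q^4)_n
   is the beta of a Bailey pair relative to 1 in base q^2, and the q-Chu-Vandermonde
   sum turns it into the finite identity
     sum_(n <= N) (q; q^2)_n (-1)^n q^(n^2) / ((q^4; q^4)_n (q^2; q^2)_(N-n))
       = (q; q^2)_N sum_(|r| <= N) q^(3 r^2) / ((q^2; q^2)_(N-r) (q^2; q^2)_(N+r)).
   Letting N tend to infinity, and evaluating the theta series by the limit of the
   finite Jacobi triple product, gives the infinite product.  All interchanges of
   limit and sum are instances of Tannery's theorem with a geometric majorant. *)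

(** * Finite q-series identities *)

Section QPochhammerTheory.
Variable K : numFieldType.
Implicit Types a b d q z Q : K.

Lemma qpoch0 a q : qpoch a q 0 = 1.
Proof. by rewrite /qpoch big_ord0. Qed.

Lemma qpochS a q n : qpoch a q n.+1 = qpoch a q n * (1 - a * q ^+ n).
Proof. by rewrite /qpoch big_ord_recr. Qed.

Lemma qpochSl a q n : qpoch a q n.+1 = (1 - a) * qpoch (a * q) q n.
Proof.
rewrite /qpoch big_ord_recl expr0 mulr1; congr (_ * _).
by apply: eq_bigr => i _; rewrite exprS mulrA.
Qed.

Lemma qpochD a q m n :
  qpoch a q (m + n) = qpoch a q m * qpoch (a * q ^+ m) q n.
Proof.
elim: n => [|n IH]; first by rewrite addn0 qpoch0 mulr1.
by rewrite addnS !qpochS IH exprD !mulrA.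
Qed.

Lemma qpoch_dissect2 a q n :
  qpoch a q (2 * n) = qpoch a (q ^+ 2) n * qpoch (a * q) (q ^+ 2) n.
Proof.
elim: n => [|n IH]; first by rewrite !qpoch0 mulr1.
rewrite (_ : 2 * n.+1 = (2 * n).+2)%N; last lia.
by rewrite !qpochS IH -!exprM [q ^+ (2 * n).+1]exprS; ring.
Qed.

Lemma qpoch_dissect3 a q n :
  qpoch a q (3 * n) = qpoch a (q ^+ 3) n * qpoch (a * q) (q ^+ 3) n
    * qpoch (a * q ^+ 2) (q ^+ 3) n.
Proof.
elim: n => [|n IH]; first by rewrite !qpoch0 !mulr1.
rewrite (_ : 3 * n.+1 = (3 * n).+3)%N; last lia.
by rewrite !qpochS IH -!exprM !exprS; ring.
Qed.

Lemma qpoch_sqr a q n :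
  qpoch (a ^+ 2) (q ^+ 2) n = qpoch a q n * qpoch (- a) q n.
Proof.
elim: n => [|n IH]; first by rewrite !qpoch0 mulr1.
by rewrite !qpochS IH -exprM mulnC exprM; ring.
Qed.

Lemma qfactS q n : qpoch q q n.+1 = qpoch q q n * (1 - q ^+ n.+1).
Proof. by rewrite qpochS -exprS. Qed.

(** The Gaussian binomial coefficient. The value 0 for [k > n] kills the end terms when Pascal's
    rule is summed over a row. *)
Definition qbin Q n k : K :=
  if (k <= n)%N then qpoch Q Q n / (qpoch Q Q k * qpoch Q Q (n - k)) else 0.

Section NotRootOfUnity.
Variable Q : K.
Hypothesis Q_free : forall n, 1 - Q ^+ n.+1 != 0.

Lemma qfact_neq0 n : qpoch Q Q n != 0.
Proof.
by elim: n => [|n IH]; rewrite ?qpoch0 ?oner_eq0// qfactS mulf_neq0.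
Qed.
Hint Resolve qfact_neq0 : core.

Lemma qbinE n k : qbin Q (n + k) k = qpoch Q Q (n + k) / (qpoch Q Q k * qpoch Q Q n).
Proof. by rewrite /qbin leq_addl addnK. Qed.

Lemma qbin_small n k : (n < k)%N -> qbin Q n k = 0.
Proof. by rewrite /qbin ltnNge => /negbTE ->. Qed.

Lemma qbinn0 n : qbin Q n 0 = 1.
Proof. by rewrite -[n]addn0 qbinE addn0 qpoch0 mul1r divff. Qed.

Lemma qbinnn n : qbin Q n n = 1.
Proof. by rewrite -[X in qbin Q X]add0n qbinE add0n qpoch0 mulr1 divff. Qed.

Lemma qbin_sub n k : (k <= n)%N -> qbin Q n (n - k) = qbin Q n k.
Proof.
move=> kn; rewrite /qbin kn leq_subr subKn //.
by rewrite [qpoch Q Q k * _]mulrC.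
Qed.

Lemma qbin_pascal n k :
  qbin Q n.+1 k.+1 = qbin Q n k + Q ^+ k.+1 * qbin Q n k.+1.
Proof.
case: (ltngtP k n) => [kn|nk|->]; last 2 first.
- by rewrite !qbin_small ?mulr0 ?addr0 //; lia.
- by rewrite !qbinnn qbin_small // mulr0 addr0.
have -> : n = (n - k.+1 + k.+1)%N by lia.
move: (n - k.+1)%N => m.
have e : (m + k.+1 = m.+1 + k)%N by rewrite addSnnS.
have hE : Q ^+ (m.+1 + k).+1 = Q ^+ m.+1 * Q ^+ k.+1 by rewrite -exprD addnS.
rewrite -[in LHS]addSn (qbinE m.+1) (qbinE m) e qbinE addnS [in LHS]qfactS hE.
rewrite !(qfactS Q m) !(qfactS Q k).
move: (Q_free k) (Q_free m) => hk hm.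
by field; rewrite !qfact_neq0 hk hm.
Qed.

Lemma qbin_pascal' n k :
  qbin Q n.+1 k.+1 = Q ^+ (n - k) * qbin Q n k + qbin Q n k.+1.
Proof.
case: (ltngtP k n) => [kn|nk|->]; last 2 first.
- by rewrite !qbin_small ?mulr0 ?addr0 //; lia.
- by rewrite !qbinnn qbin_small // subnn mul1r addr0.
have e : (n - k = (n - k.+1).+1)%N by lia.
rewrite -(@qbin_sub n.+1 k.+1) ?ltnS 1?ltnW // subSS e qbin_pascal -e.
by rewrite !qbin_sub // 1?ltnW // addrC.
Qed.

Lemma qbin_absorb n k : (k <= n.+1)%N ->
  qbin Q n.+1 k * (1 - Q ^+ (n.+1 - k)) = (1 - Q ^+ n.+1) * qbin Q n k.
Proof.
rewrite leq_eqVlt => /predU1P[->|kn].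
  by rewrite subnn expr0 subrr mulr0 qbin_small ?mulr0.
have -> : n = (n - k + k)%N by lia.
move: (n - k)%N => m.
rewrite -addSn addnK !qbinE addSn !qfactS.
move: (Q_free m) => hm.
by field; rewrite !qfact_neq0 hm.
Qed.

(** Pascal's rule summed against a weight: row [n.+1] becomes row [n] with a new weight, so that
    inductions on the row reduce to comparing summands. *)
Lemma sum_qbinS n (f : nat -> K) :
  \sum_(k < n.+2) qbin Q n.+1 k * f k =
  \sum_(k < n.+1) qbin Q n k * (Q ^+ k * f k + f k.+1).
Proof.
rewrite big_ord_recl /= qbinn0 mul1r.
under eq_bigr do rewrite /= /bump /= add1n qbin_pascal mulrDl.
under [RHS]eq_bigr do rewrite mulrDr.
rewrite !big_split /= addrCA addrC; congr (_ + _).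
rewrite [RHS]big_ord_recl big_ord_recr /= qbinn0 qbin_small // mulr0 mul0r addr0.
rewrite expr0 !mul1r; congr (_ + _).
by apply: eq_bigr => i _; rewrite /bump /= add1n mulrAC mulrC mulrA.
Qed.

Lemma sum_qbinS' n (f : nat -> K) :
  \sum_(k < n.+2) qbin Q n.+1 k * f k =
  \sum_(k < n.+1) qbin Q n k * (f k + Q ^+ (n - k) * f k.+1).
Proof.
rewrite big_ord_recl /= qbinn0 mul1r.
under eq_bigr do rewrite /= /bump /= add1n qbin_pascal' mulrDl.
under [RHS]eq_bigr do rewrite mulrDr.
rewrite !big_split /= addrCA [RHS]addrC; congr (_ + _).
  by apply: eq_bigr => i _; rewrite mulrAC mulrC mulrA.
rewrite [RHS]big_ord_recl big_ord_recr /= qbinn0 qbin_small // mul0r addr0.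
by rewrite mul1r.
Qed.

(** The sum 2phi1(Q^(-M), b; b d; Q, d Q^M), multiplied by (b d; Q)_M so that no denominator depends
    on [b] or [d]. The induction on [M] keeps [b] free because its step uses both [b] and
    [b * Q]. *)
Lemma qChu_Vandermonde b d M :
  \sum_(m < M.+1) qbin Q M m * (qpoch b Q m * (- d) ^+ m * Q ^+ 'C(m, 2)
     * qpoch (b * d * Q ^+ m) Q (M - m)) = qpoch d Q M.
Proof.
elim: M b => [|M IH] b.
  by rewrite big_ord1 qbinn0 !qpoch0 !expr0 !mulr1.
pose g b m := qpoch b Q m * (- d) ^+ m * Q ^+ 'C(m, 2)
  * qpoch (b * d * Q ^+ m) Q (M - m).
rewrite (sum_qbinS' _ (fun m => qpoch b Q m * (- d) ^+ m * Q ^+ 'C(m, 2)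
     * qpoch (b * d * Q ^+ m) Q (M.+1 - m))) /=.
(* By induction both sums equal (d; Q)_M, and the coefficients add up to 1 - d Q^M. *)
transitivity (\sum_(m < M.+1) ((1 - b * d * Q ^+ M) * (qbin Q M m * g b m)
    - d * (1 - b) * Q ^+ M * (qbin Q M m * g (b * Q) m))).
  apply: eq_bigr => -[m /= hm] _; rewrite /g subSS.
  rewrite [in qpoch b Q m.+1]qpochSl (_ : M.+1 - m = (M - m).+1)%N; last lia.
  rewrite qpochS binS bin1 !exprD [(- d) ^+ m.+1]exprS.
  rewrite (_ : b * Q * d * Q ^+ m = b * d * Q ^+ m.+1); last by rewrite [Q ^+ m.+1]exprS; ring.
  have -> : Q ^+ M = Q ^+ (M - m) * Q ^+ m by rewrite -exprD subnK.
  ring.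
rewrite sumrB -!mulr_sumr !IH qpochS; ring.
Qed.

(** One of the two truncated differences vanishes, so this is the integer square of m - n. It lets
    sums over -n..n be written over 0..2n. *)
Definition sqdist (m n : nat) : nat := ((m - n) ^ 2 + (n - m) ^ 2)%N.

Lemma sqdistSl m n : (sqdist m.+1 n + 2 * n = sqdist m n + (2 * m).+1)%N.
Proof. rewrite /sqdist; case: (leqP n m) => h; nia. Qed.

Lemma sqdistDr n r : sqdist n (n + r) = (r ^ 2)%N.
Proof. rewrite /sqdist; nia. Qed.

Lemma sqdist_subr n r : (r <= n)%N -> sqdist n (n - r) = (r ^ 2)%N.
Proof. rewrite /sqdist; nia. Qed.

(** One use of Pascal's rule goes from row 2n+2 to row 2n+1 and leaves a factor 1 - Q^(2n+1-j).
    [qbin_absorb] turns it into 1 - Q^(2n+1) and lowers the row to 2n, which is the recurrence of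
    the right-hand side. *)
Lemma gauss_alternating n :
  \sum_(j < (2 * n).+1) qbin Q (2 * n) j * ((-1) ^+ j * Q ^+ sqdist n j) =
  (-1) ^+ n * qpoch Q (Q ^+ 2) n.
Proof.
elim: n => [|n IH].
  by rewrite big_ord1 qpoch0 qbinn0 !mulr1.
rewrite (_ : 2 * n.+1 = (2 * n).+2)%N; last lia.
rewrite (sum_qbinS _ (fun j => (-1) ^+ j * Q ^+ sqdist n.+1 j)).
rewrite (eq_bigr (fun j : 'I_(2 * n).+2 =>
   - (1 - Q ^+ (2 * n).+1) * (qbin Q (2 * n) j * ((-1) ^+ j * Q ^+ sqdist n j)))).
  rewrite -mulr_sumr big_ord_recr /= qbin_small // mul0r addr0 IH qpochS.
  by rewrite -exprM !exprS; ring.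
move=> -[j /= hj] _.
have -> : sqdist n.+1 j.+1 = sqdist n j by rewrite /sqdist !subSS.
have hE : Q ^+ j * Q ^+ sqdist n.+1 j = Q ^+ ((2 * n).+1 - j) * Q ^+ sqdist n j.
  by rewrite -!exprD; congr (Q ^+ _); have := sqdistSl n j; lia.
rewrite mulrCA hE mulNr [in RHS]mulrA -(@qbin_absorb (2 * n) j) //.
rewrite [(-1) ^+ j.+1]exprS.
ring.
Qed.

End NotRootOfUnity.

(** The number of integers with absolute value [r]: it folds an even sum over the integers onto r >=
    0. *)
Definition fold_weight (r : nat) : K := if r is 0 then 1 else 2.

Lemma sum_fold n (f : nat -> K) :
  (forall r, (r <= n)%N -> f (n - r)%N = f (n + r)%N) ->
  \sum_(j < (2 * n).+1) f j = \sum_(r < n.+1) fold_weight r * f (n + r)%N.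
Proof.
move=> fsym; rewrite [RHS]big_ord_recl /= mul1r addn0.
rewrite -mulr_sumr (_ : (2 * n).+1 = n + n.+1)%N; last lia.
rewrite big_split_ord big_ord_recl /= addrCA addn0; congr (_ + _).
rewrite mulr_natl mulr2n; congr (_ + _).
rewrite (reindex_inj rev_ord_inj) /=; apply: eq_bigr => i _.
by rewrite fsym // /bump add1n.
Qed.

(** The usual Laurent sum over -N..M is multiplied by z^N, so only natural powers of [z] occur. Each
    of the two Pascal rules adds one factor to one of the two products. *)
Lemma finite_jacobi_triple q z M N : (forall n, 1 - (q ^+ 2) ^+ n.+1 != 0) ->
  \sum_(j < (M + N).+1) qbin (q ^+ 2) (M + N) j * (z ^+ j * q ^+ sqdist N j) =
  \prod_(i < M) (1 + z * q ^+ (2 * i).+1) * \prod_(i < N) (z + q ^+ (2 * i).+1).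
Proof.
move=> hq; elim: N => [|N IH].
  (* The case [N = 0] is the q-binomial theorem, by induction on [M]. *)
  rewrite addn0 big_ord0 mulr1; elim: M => [|M IH].
    by rewrite big_ord1 big_ord0 qbinn0 // !mulr1.
  rewrite (sum_qbinS' hq _ (fun j => z ^+ j * q ^+ sqdist 0 j)).
  rewrite [in RHS]big_ord_recr /= -IH mulr_suml; apply: eq_bigr => -[j /= hj] _.
  rewrite -mulrA; congr (_ * _); rewrite /sqdist !sub0n !subn0 !add0n.
  rewrite -exprM [z ^+ j.+1]exprS [q ^+ (2 * M).+1]exprS mulrDr mulr1; congr (_ + _).
  rewrite (_ : q ^+ (2 * M) = q ^+ (2 * (M - j)) * q ^+ (2 * j)); last first.
    by rewrite -exprD; congr (_ ^+ _); lia.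
  rewrite (_ : j.+1 ^ 2 = j ^ 2 + 2 * j + 1)%N ?exprD; last nia.
  by rewrite expr1; ring.
rewrite addnS (sum_qbinS hq _ (fun j => z ^+ j * q ^+ sqdist N.+1 j)).
rewrite [in RHS]big_ord_recr /= mulrA -IH mulr_suml; apply: eq_bigr => -[j /= hj] _.
rewrite -mulrA; congr (_ * _).
rewrite (_ : sqdist N.+1 j.+1 = sqdist N j); last by rewrite /sqdist !subSS.
rewrite -exprM mulrCA -exprD addnC sqdistSl exprD [z ^+ j.+1]exprS; ring.
Qed.

Lemma bin2_sqr m : (2 * 'C(m, 2) + m = m ^ 2)%N.
Proof. elim: m => // m; rewrite binS bin1; nia. Qed.

(** The finite triple product at z = 1 with M = N, folded around its centre. *)
Lemma theta_finite q N : (forall n, 1 - (q ^+ 2) ^+ n.+1 != 0) ->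
  \sum_(r < N.+1) fold_weight r * (q ^+ (r ^ 2) *
     (qpoch (q ^+ 2) (q ^+ 2) (2 * N) /
      (qpoch (q ^+ 2) (q ^+ 2) (N - r) * qpoch (q ^+ 2) (q ^+ 2) (N + r)))) =
  qpoch (- q) (q ^+ 2) N ^+ 2.
Proof.
move=> hq; have := finite_jacobi_triple 1 N N hq.
rewrite addnn -mul2n (@sum_fold _ (fun j => qbin _ _ j * (1 ^+ j * q ^+ sqdist N j))).
  have -> : \prod_(i < N) (1 + q ^+ (2 * i).+1) = qpoch (- q) (q ^+ 2) N.
    by apply: eq_bigr => i _; rewrite -exprM exprS mulNr opprK.
  under [in X in _ = X -> _]eq_bigr do rewrite mul1r.
  have -> : \prod_(i < N) (1 + q ^+ (2 * i).+1) = qpoch (- q) (q ^+ 2) N.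
    by apply: eq_bigr => i _; rewrite -exprM exprS mulNr opprK.
  rewrite -expr2 => <-; apply: eq_bigr => -[r /= hr] _.
  congr (_ * _); rewrite sqdistDr expr1n mul1r mulrC; congr (_ * _).
  have hr' : (N + r <= 2 * N)%N by lia.
  rewrite /qbin hr' (_ : 2 * N - (N + r) = N - r)%N; last lia.
  by rewrite [X in _ / X]mulrC.
move=> r hr; rewrite !expr1n sqdistDr sqdist_subr // (_ : N - r = 2 * N - (N + r))%N; last lia.
by rewrite qbin_sub //; lia.
Qed.

(* The Bailey pair relative to 1 with [beta n = 1 / (Q^2; Q^2)_n] and
   [alpha n = fold_weight n * (-1)^n * Q^(n^2)]. *)
Lemma bailey_pair Q n : (forall n, 1 - Q ^+ n.+1 != 0) ->
  (qpoch (Q ^+ 2) (Q ^+ 2) n)^-1 =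
  \sum_(r < n.+1) fold_weight r * ((-1) ^+ r * Q ^+ (r ^ 2)) /
     (qpoch Q Q (n - r) * qpoch Q Q (n + r)).
Proof.
move=> hQ; have := gauss_alternating hQ n.
rewrite (@sum_fold _ (fun j => qbin _ _ j * ((-1) ^+ j * Q ^+ sqdist n j))); last first.
  move=> r hr; rewrite sqdistDr sqdist_subr // (_ : n - r = 2 * n - (n + r))%N; last lia.
  rewrite qbin_sub; [congr (_ * (_ * _))|lia].
  by rewrite -signr_odd -[RHS]signr_odd oddB ?oddM //; lia.
move=> hA.
have := qpoch_dissect2 Q Q n; rewrite -expr2 => hP.
have := qfact_neq0 hQ (2 * n); rewrite hP mulf_eq0 negb_or => /andP[h1 h2].
apply: (mulfI h1); have s0 : (-1) ^+ n != 0 :> K by rewrite signr_eq0.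
apply: (mulfI s0).
rewrite mulrA -hA mulr_suml mulrA mulr_sumr; apply: eq_bigr => -[r /= hr] _.
have hr' : (n + r <= 2 * n)%N by lia.
rewrite /qbin hr' (_ : 2 * n - (n + r) = n - r)%N; last lia.
rewrite hP sqdistDr exprD.
by field; rewrite h2 !qfact_neq0.
Qed.

(** This is [qChu_Vandermonde] in base Q = q^2 with b = d = q^(2r+1) and M = N - r. Then b d Q^m =
    Q^(2r+m+1), so the last factor there is a quotient of two values of (Q; Q). *)
Lemma bailey_inner_sum q N r : (forall n, 1 - (q ^+ 2) ^+ n.+1 != 0) -> (r <= N)%N ->
  \sum_(m < (N - r).+1) qpoch q (q ^+ 2) (r + m) * (-1) ^+ (r + m) * q ^+ ((r + m) ^ 2) /
     (qpoch (q ^+ 2) (q ^+ 2) (N - (r + m)) *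
       (qpoch (q ^+ 2) (q ^+ 2) m * qpoch (q ^+ 2) (q ^+ 2) (r + m + r))) =
  (-1) ^+ r * q ^+ (r ^ 2) * qpoch q (q ^+ 2) N /
     (qpoch (q ^+ 2) (q ^+ 2) (N - r) * qpoch (q ^+ 2) (q ^+ 2) (N + r)).
Proof.
move=> hq hr; set Q := q ^+ 2; set b := q * Q ^+ r.
have P0 := qfact_neq0 hq.
have -> : N = (r + (N - r))%N by lia.
rewrite (addKn r); move: (N - r)%N => M {N hr}.
rewrite qpochD -/b -(qChu_Vandermonde hq b b M).
rewrite mulrA mulr_sumr mulr_suml; apply: eq_bigr => -[m /= hm] _.
have -> : b * b * Q ^+ m = Q * Q ^+ (r + m + r).
  by rewrite /b /Q -!exprM -!exprS -!exprD; congr (q ^+ _); lia.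
have -> : qpoch (Q * Q ^+ (r + m + r)) Q (M - m) =
    qpoch Q Q (r + M + r) / qpoch Q Q (r + m + r).
  rewrite (_ : r + M + r = r + m + r + (M - m))%N; last lia.
  by apply: (canRL (mulfK (P0 _))); rewrite mulrC -qpochD.
rewrite (_ : r + M - (r + m) = M - m)%N; last lia.
rewrite qpochD -/b /qbin -ltnS hm.
have -> : q ^+ ((r + m) ^ 2) = q ^+ (r ^ 2) * (b ^+ m * Q ^+ 'C(m, 2)).
  rewrite /b /Q -!exprM -exprS -!exprM -!exprD.
  by congr (q ^+ _); have := bin2_sqr m; nia.
rewrite [(- b) ^+ m]exprNn exprD.
by field; rewrite !P0.
Qed.


Lemma sum_ord_geq r N (f : nat -> K) : (r <= N)%N ->
  \sum_(n < N.+1 | (r < n.+1)%N) f n = \sum_(m < (N - r).+1) f (r + m)%N.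
Proof.
move=> hr; rewrite -[in LHS](subnKC hr); move: (N - r)%N => M; rewrite -addnS.
rewrite big_split_ord big1 /= ?add0r => [|i]; last by have := ltn_ord i; lia.
by apply: eq_bigl => i; lia.
Qed.

(** Expand 1 / (q^4; q^4)_n by the Bailey pair in base q^2, exchange the sums, and evaluate the sum
    over [n] by [bailey_inner_sum]. *)
Lemma bailey_finite q N : (forall n, 1 - (q ^+ 2) ^+ n.+1 != 0) ->
  \sum_(n < N.+1) qpoch q (q ^+ 2) n * (-1) ^+ n * q ^+ (n ^ 2) /
     qpoch (q ^+ 4) (q ^+ 4) n / qpoch (q ^+ 2) (q ^+ 2) (N - n) =
  qpoch q (q ^+ 2) N * \sum_(r < N.+1) fold_weight r * (q ^+ (3 * r ^ 2) /
     (qpoch (q ^+ 2) (q ^+ 2) (N - r) * qpoch (q ^+ 2) (q ^+ 2) (N + r))).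
Proof.
move=> hq; rewrite (_ : q ^+ 4 = (q ^+ 2) ^+ 2); last by rewrite -exprM.
pose P := qpoch (q ^+ 2) (q ^+ 2).
pose a r := fold_weight r * ((-1) ^+ r * (q ^+ 2) ^+ (r ^ 2)).
pose c n := qpoch q (q ^+ 2) n * (-1) ^+ n * q ^+ (n ^ 2).
transitivity (\sum_(n < N.+1) \sum_(r < N.+1 | (r < n.+1)%N)
    a r * (c n / (P (N - n)%N * (P (n - r)%N * P (n + r)%N)))).
  apply: eq_bigr => -[n /= hn] _; rewrite bailey_pair // mulr_sumr mulr_suml.
  rewrite -(big_ord_widen _ (fun r => a r * (c n / (P (N - n)%N * (P (n - r)%N * P (n + r)%N))))) //.
  apply: eq_bigr => r _; rewrite -/P -/(a r) -/(c n).
  by field; rewrite !qfact_neq0.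
rewrite (exchange_big_dep xpredT) //= mulr_sumr; apply: eq_bigr => -[r /= hr] _.
rewrite -mulr_sumr (@sum_ord_geq _ _ (fun n => c n / (P (N - n)%N * (P (n - r)%N * P (n + r)%N)))) //.
under eq_bigr => m _ do rewrite addKn.
rewrite bailey_inner_sum // /a -/P.
(* The pair contributes q^(2 r^2) and the inner sum q^(r^2); their two signs (-1)^r cancel. *)
rewrite (_ : 3 * r ^ 2 = 2 * r ^ 2 + r ^ 2)%N; last lia.
rewrite exprD exprM -[RHS]mul1r -[X in _ = X * _](@sqrr_sign K r).
by field; rewrite !qfact_neq0.
Qed.

End QPochhammerTheory.

(** * Coding of P_4 by words *)

Section P4Words.

Lemma P4_seq1 x : P4 [:: x] = (x == 1 %[mod 4])%N || (x == 2 %[mod 4])%N.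
Proof. by rewrite /P4 /distinct_partition /= !andbT; case: x. Qed.

Lemma P4_cons2 x y s : P4 [:: x, y & s] = [&& (y < x)%N, P4_gap x y & P4 (y :: s)].
Proof.
rewrite /P4 /distinct_partition /=; case: (ltnP y x) => //= yx.
rewrite (leq_trans _ yx) //=.
by case: (P4_gap x y); rewrite /= ?andbF.
Qed.

Definition residue (b : bool) : nat := (if b then 1 else 2)%N.

Definition head_residue (s : seq nat) : nat :=
  if s is x :: _ then residue (odd x) else 0%N.

(* The gap between consecutive parts of residues [r, r' \in {1, 2}] (1 for odd
   parts) is [r + r' + 4 k], and so is the last part, with [r' = 0]. *)
Fixpoint P4_of_word (t : seq (bool * nat)) : seq nat :=
  if t is (b, k) :: t' then
    let s := P4_of_word t' in
    (head 0 s + residue b + head_residue s + 4 * k)%N :: s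
  else [::].

(** A part plus its own residue is even, so the residue of the new part alone decides its parity. *)
Lemma odd_next b y k : odd (y + residue b + residue (odd y) + 4 * k) = b.
Proof. by rewrite /residue; case: b; case: (boolP (odd y)); lia. Qed.

Lemma P4_of_wordP t : P4 (P4_of_word t).
Proof.
elim: t => [//|[b k] t /=]; case: (P4_of_word t) => [_|y s IH].
  by rewrite P4_seq1 /residue /=; case: b; lia.
rewrite P4_cons2 IH andbT /P4_gap odd_next -!addnA addKn /=.
by case: b; case: (odd y); rewrite /=; lia.
Qed.

Lemma P4_of_word_inj : injective P4_of_word.
Proof.
elim=> [|[b k] t IH] [|[b' k'] t'] //= [+ /IH e]; rewrite -{}e => h.
suff [-> ->] : b = b' /\ k = k' by [].
move: h; rewrite /residue; case: (P4_of_word t) => [|y s] /=.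
  by case: b; case: b'; lia.
by case: b; case: b'; case: (odd y); lia.
Qed.

Lemma P4_of_word_surj s : P4 s -> exists t, P4_of_word t = s.
Proof.
elim: s => [|x s IH]; first by exists [::].
case: s IH => [_|y s IH].
  rewrite P4_seq1 => hx; exists [:: (odd x, (x %/ 4)%N)] => /=.
  by rewrite /residue; congr [:: _]; case: (boolP (odd x)); lia.
rewrite P4_cons2 => /and3P[yx gap /IH[t ht]].
(* The gap is at least the sum of the residues, so truncation loses nothing. For two even parts, y <
   x excludes gap 0 and leaves at least 4. *)
exists ((odd x, (x - y - residue (odd x) - residue (odd y)) %/ 4)%N :: t) => /=.
rewrite ht /=; congr (_ :: _).
move: gap; rewrite /P4_gap /residue.
by case: (boolP (odd x)); case: (boolP (odd y)); lia.
Qed.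

Definition letters (M : nat) : seq (bool * nat) :=
  [seq (b, k) | b <- [:: true; false], k <- iota 0 M].

Lemma mem_letters M x : (x \in letters M) = (x.2 < M)%N.
Proof.
apply/allpairsP/idP => [[[b k] [_ + ->]] /=|]; first by rewrite mem_iota.
by case: x => b k hk; exists (b, k); rewrite mem_iota !inE; case: b hk.
Qed.

Lemma letters_uniq M : uniq (letters M).
Proof.
by apply: allpairs_uniq; rewrite ?iota_uniq // => -[b k] [b' k'].
Qed.

Fixpoint words (M n : nat) : seq (seq (bool * nat)) :=
  if n is n'.+1 then [seq x :: t | x <- letters M, t <- words M n'] else [:: [::]].

Lemma mem_words M n t :
  (t \in words M n) = (size t == n) && all (fun x => x.2 < M)%N t.
Proof.
elim: n t => [|n IH] [|x t] //=; first by apply/negbTE/negP => /allpairsP[[? ?] []].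
rewrite eqSS andbCA -IH -mem_letters.
apply/allpairsP/andP => [[[y u] /= [hy hu [-> ->]]]|[hx ht]]; first by [].
by exists (x, t).
Qed.

Lemma words_uniq M n : uniq (words M n).
Proof.
elim: n => //= n IH; apply: allpairs_uniq => //.
  exact: letters_uniq.
by move=> [x t] [y u] _ _ /= [-> ->].
Qed.

(** * Weights of words and their generating function *)

Section Weight.
Variable K : numFieldType.
Variables s q : K.

(** A letter preceded by [c] others (larger parts) has its 4 k counted in c + 1 parts. Its residue
    enters its own gap, counted c + 1 times, and the gap above, counted c times: 2 c + 1 in all. The
    variable [s] marks odd parts: -1 gives the signed sum, 1 its majorant. *)
Definition letter_weight (c : nat) (x : bool * nat) : K :=
  (if x.1 then s * q ^+ (2 * c).+1 else q ^+ (2 * (2 * c).+1)) * q ^+ (4 * c.+1 * x.2).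

Fixpoint word_weight (c : nat) (t : seq (bool * nat)) : K :=
  if t is x :: t' then letter_weight c x * word_weight c.+1 t' else 1.

(** The induction needs the list below [c] larger parts: each of these is raised by the head of the
    list and its residue. *)
Lemma word_weight_shift c t : let l := P4_of_word t in
  s ^+ odd_parts l * q ^+ (sumn l + c * (head 0 l + head_residue l)) = word_weight c t.
Proof.
elim: t c => [|[b k] t IH] c /=; first by rewrite muln0 mulr1.
move/(_ c.+1): IH => /=; rewrite /letter_weight; move: (P4_of_word t) => l <- /=.
have -> : odd (head 0 l + residue b + head_residue l + 4 * k) = b.
  by case: l => [|y l]; [case: b => /=; lia | exact: odd_next].
set h := (head 0 l + head_residue l)%N.
have -> : (head 0 l + residue b + head_residue l + 4 * k + sumn l
    + c * (head 0 l + residue b + head_residue l + 4 * k + residue b)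
  = (2 * c).+1 * residue b + 4 * c.+1 * k + (sumn l + c.+1 * h))%N by rewrite /h; nia.
move: (4 * c.+1 * k)%N (sumn l + c.+1 * h)%N (2 * c).+1 => x y z.
rewrite 2!(exprD q) (exprD s); case: b => /=; rewrite ?muln1 ?mul1r ?expr1; first by ring.
by rewrite [(z * 2)%N]mulnC; ring.
Qed.

Lemma word_weight0 t :
  s ^+ odd_parts (P4_of_word t) * q ^+ sumn (P4_of_word t) = word_weight 0 t.
Proof. by rewrite -word_weight_shift addn0. Qed.

Lemma sum_words M n c :
  \sum_(t <- words M n) word_weight c t =
  \prod_(i < n) ((s * q ^+ (2 * (c + i)).+1 + q ^+ (2 * (2 * (c + i)).+1))
     * \sum_(k < M) q ^+ (4 * (c + i).+1 * k)).
Proof.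
elim: n c => [|n IH] c; first by rewrite big_seq1 big_ord0.
rewrite big_ord_recl addn0 /= big_allpairs_dep /=.
under eq_bigr do rewrite -mulr_sumr IH.
rewrite -mulr_suml; congr (_ * _); last first.
  by apply: eq_bigr => i _; rewrite /bump /= addSnnS.
rewrite big_allpairs_dep /= big_cons big_seq1 /letter_weight /= -!mulr_sumr -mulrDl.
by congr (_ * _); rewrite -(big_mkord xpredT (fun k => q ^+ (4 * c.+1 * k))) /index_iota subn0.
Qed.

End Weight.
End P4Words.

(** * Series and limits in the complex numbers *)

Section ComplexSeries.
Variable R : realType.
Local Notation C := (R[i] : numFieldType).
Local Notation "x %:C" := (real_complex R x : C).

(** Norms and bounds live in C; this moves estimates to R, where exponentials, suprema and
    comparison tests are available. *)
Lemma ge0_complexP {x : C} : 0 <= x -> exists2 a : R, 0 <= a & x = a%:C.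
Proof.
move=> x0; have /complex_realP[a xa] := ger0_real x0.
by exists a => //; move: x0; rewrite xa ler0c.
Qed.

Lemma cvg_norm_exp (q : C) : `|q| < 1 -> (fun n => `|q| ^+ n) @ \oo --> (0 : C).
Proof.
have [r r0 hr] := ge0_complexP (normr_ge0 q); rewrite hr.
rewrite -[1]/(1%:C) ltcR => r1.
apply/cvgr0Pnorm_lt => e e0.
have [e' _ he] := ge0_complexP (ltW e0).
move: e0; rewrite he -[0]/(0%:C) ltcR => e0.
have /cvgr0Pnorm_lt/(_ e' e0) : (fun n => r ^+ n) @ \oo --> (0 : R).
  by apply: cvg_expr; rewrite ger0_norm.
apply: filterS => n; rewrite -rmorphXn /= ger0_norm ?exprn_ge0 // => h.
by rewrite ger0_norm ?ler0c ?exprn_ge0 // ltcR.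
Qed.

(** From 1 + y <= exp y and the geometric series, exp (c / (1 - x)) is a bound. *)
Lemma prod_1Dgeom_bounded (c x : C) : 0 <= c -> 0 <= x -> x < 1 ->
  exists2 B, 0 < B & forall n, \prod_(i < n) (1 + c * x ^+ i) <= B.
Proof.
move=> /ge0_complexP[c' c0 ->] /ge0_complexP[r r0 ->]; rewrite -[1]/(1%:C) ltcR => r1.
exists (expR (c' / (1 - r)))%:C; first by rewrite -[0]/(0%:C) ltcR expR_gt0.
move=> n; under eq_bigr do rewrite -rmorphXn -rmorphM -rmorphD.
rewrite -rmorph_prod lecR.
have r10 : 0 < 1 - r by rewrite subr_gt0.
apply: (@le_trans _ _ (\prod_(i < n) expR (c' * r ^+ i))).
  by apply: ler_prod => i _; rewrite expR_ge1Dx addr_ge0 // mulr_ge0 ?exprn_ge0.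
rewrite -expR_sum ler_expR -mulr_sumr ler_pdivlMr // -mulrA ler_piMr //.
have := subrX1 r n; have : 0 <= r ^+ n by apply: exprn_ge0.
by move=> h1 h2; rewrite mulrC -opprB mulNr -h2 opprB gerBl.
Qed.

Lemma geom_sum_le (x : C) m n : 0 <= x -> x < 1 -> (m <= n)%N ->
  \sum_(m <= i < n) x ^+ i <= x ^+ m / (1 - x).
Proof.
move=> x0 x1 mn; have x10 : 0 < 1 - x by rewrite subr_gt0.
rewrite ler_pdivlMr // mulr_suml.
rewrite (eq_bigr (fun i => - (x ^+ i.+1 - x ^+ i))); last first.
  by move=> i _; rewrite exprS; ring.
by rewrite sumrN telescope_sumr // opprB gerBl exprn_ge0.
Qed.

(** Real and imaginary parts converge absolutely by comparison with a real geometric series. *)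
Lemma cvg_series_geom (u : nat -> C) (M q : C) : `|q| < 1 ->
  (forall n, `|u n| <= M * `|q| ^+ n) -> cvgn (series u).
Proof.
move=> q1 hu.
have M0 : 0 <= M by have := hu 0; rewrite expr0 mulr1; apply: le_trans.
have [b b0 hb] := ge0_complexP M0.
have [r r0 hr] := ge0_complexP (normr_ge0 q).
move: q1; rewrite hr -[1]/(1%:C) ltcR => r1.
have cvgF (F : C -> R) : (forall x, `|F x|%:C <= `|x|) -> cvgn (series (F \o u)).
  move=> hF; apply: normed_cvg; apply: (@series_le_cvg _ _ (geometric b r)).
  - by move=> n /=.
  - by move=> n /=; rewrite mulr_ge0 ?exprn_ge0.
  - move=> n /=; rewrite -lecR; apply: (le_trans (hF _)); apply: (le_trans (hu n)).
    by rewrite hb hr -rmorphXn -rmorphM.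
  - by apply: is_cvg_geometric_series; rewrite ger0_norm.
have hRe (x : C) : `|complex.Re x|%:C <= `|x| by exact: normc_ge_Re.
have hIm (x : C) : `|complex.Im x|%:C <= `|x|.
  have := normc_ge_Re (x * 'i%C); rewrite ReiNIm normrN normrM.
  by rewrite [X in _ * X](_ : _ = 1) ?mulr1 // normc_def /= expr0n add0r expr1n sqrtr1.
have /cvg_ex[a ha] := cvgF _ hRe; have /cvg_ex[c hc] := cvgF _ hIm.
apply/cvg_ex; exists (a +i* c)%C; apply/cvgrPdist_lt => e e0.
have [e' _ he] := ge0_complexP (ltW e0).
move: e0; rewrite he -[0]/(0%:C) ltcR => e0.
have e20 : 0 < e' / 2 by rewrite divr_gt0.
move/cvgrPdist_lt/(_ _ e20): ha; move/cvgrPdist_lt/(_ _ e20): hc.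
apply: filterS2 => n hcn han.
have -> : (a +i* c)%C - series u n =
   (a - series (@complex.Re R \o u) n)%:C + 'i%C * (c - series (@complex.Im R \o u) n)%:C.
  have -> : series (@complex.Re R \o u) n = @complex.Re R (series u n).
    by rewrite !seriesEnat /= (big_morph (@complex.Re R) (id1 := 0) (op1 := +%R) (op2 := +%R) (id2 := 0)) // => -[? ?] [].
  have -> : series (@complex.Im R \o u) n = @complex.Im R (series u n).
    by rewrite !seriesEnat /= (big_morph (@complex.Im R) (id1 := 0) (op1 := +%R) (op2 := +%R) (id2 := 0)) // => -[? ?] [].
  by case: (series u n) => x y; simpc.
apply: (le_lt_trans (ler_normD _ _)); rewrite normrM.
rewrite [X in _ + X * _](_ : _ = 1) ?mul1r; last first.
  by rewrite normc_def /= expr0n add0r expr1n sqrtr1.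
have normR (x : R) : `|x%:C| = `|x|%:C by rewrite normc_def /= expr0n addr0 sqrtr_sqr.
rewrite !normR -rmorphD ltcR [e']splitr; exact: ltrD.
Qed.

Lemma cvg_sum_pointwise (d : nat -> nat -> C) m :
  (forall n, d ^~ n @ \oo --> (0 : C)) ->
  (fun N => \sum_(0 <= n < m) d N n) @ \oo --> (0 : C).
Proof.
move=> hd; elim: m => [|m IH].
  by under eq_fun do rewrite big_nil; exact: cvg_cst.
under eq_fun do rewrite big_nat_recr //=.
by have := cvgD IH (hd m); rewrite addr0; apply.
Qed.

(** The differences a - b are dominated by 2 M |q|^n. A cut-off [m], chosen before [N], makes their
    tail less than e / 2; the finitely many terms below it tend to 0. *)
Lemma tannery (a : nat -> nat -> C) (b : nat -> C) (M q l : C) : `|q| < 1 ->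
  (forall N n, `|a N n| <= M * `|q| ^+ n) ->
  (forall n, a ^~ n @ \oo --> b n) ->
  series b @ \oo --> l ->
  (fun N => \sum_(n < N.+1) a N n) @ \oo --> l.
Proof.
move=> q1 ha hab hb.
have M0 : 0 <= M by have := ha 0 0; rewrite expr0 mulr1; apply: le_trans.
have bM n : `|b n| <= M * `|q| ^+ n.
  apply/ler_addgt0Pl => e e0.
  have /cvgrPdist_lt/(_ e e0) [N _ /(_ N (leqnn N)) hN] := hab n.
  rewrite -[b n](subrK (a N n)) (le_trans (ler_normD _ _)) // lerD //.
  exact: ltW.
pose d N n := a N n - b n.
have dM N n : `|d N n| <= M * 2 * `|q| ^+ n.
  by rewrite (le_trans (ler_normB _ _)) // mulrAC mulr_natr mulr2n lerD.
have d0 n : d ^~ n @ \oo --> (0 : C).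
  have : (fun N => a N n - b n) @ \oo --> b n - b n.
    by apply: cvgB; [exact: hab | exact: cvg_cst].
  by rewrite subrr.
have -> : (fun N => \sum_(n < N.+1) a N n) =
    (fun N => \sum_(0 <= n < N.+1) d N n + series b N.+1).
  apply/funext => N; rewrite seriesEnat /= -big_split /= big_mkord.
  by apply: eq_bigr => i _; rewrite subrK.
rewrite -[l]add0r; apply: cvgD; last by rewrite cvg_shiftS.
apply/cvgr0Pnorm_lt => e e0; have e20 : 0 < e / 2 by rewrite divr_gt0.
have q10 : 0 < 1 - `|q| by rewrite subr_gt0.
have : (fun m => M * 2 * (`|q| ^+ m / (1 - `|q|))) @ \oo -->
    M * 2 * (0 * (1 - `|q|)^-1).
  by apply: cvgMl_tmp; apply: cvgMr_tmp; exact: cvg_norm_exp.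
rewrite mul0r mulr0.
move=> /cvgr0Pnorm_lt/(_ _ e20)[m _ /(_ m (leqnn m)) hm].
have /cvgr0Pnorm_lt/(_ _ e20) := cvg_sum_pointwise m d0.
apply: filterS2 (nbhs_infty_ge m) => N hN hd.
rewrite (@big_cat_nat _ _ _ m) //=; last exact: leqW.
rewrite (le_lt_trans (ler_normD _ _)) // [e]splitr ltrD //.
have T0 : 0 <= M * 2 * (`|q| ^+ m / (1 - `|q|)).
  by rewrite !mulr_ge0 ?exprn_ge0 ?invr_ge0 // ltW.
rewrite (ger0_norm T0) in hm; apply: le_lt_trans hm.
apply: (le_trans (ler_norm_sum _ _ _)).
apply: (@le_trans _ _ (\sum_(m <= n < N.+1) M * 2 * `|q| ^+ n)).
  by apply: ler_sum => n _; exact: dM.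
rewrite -mulr_sumr ler_wpM2l ?mulr_ge0 //.
by apply: geom_sum_le => //; exact: leqW.
Qed.

End ComplexSeries.

(** * Unordered sums along exhausting finite families *)

Section UnorderedSum.
Variable R : realType.
Local Notation C := (R[i] : numFieldType).
Local Notation "x %:C" := (real_complex R x : C).

Lemma sum_subset_uniq (I : eqType) (V : zmodType) (f : I -> V) (s t : seq I) :
  uniq s -> uniq t -> {subset t <= s} ->
  \sum_(i <- s) f i = \sum_(i <- t) f i + \sum_(i <- s | i \notin t) f i.
Proof.
move=> us ut ts; rewrite (bigID (mem t)) /=; congr (_ + _).
rewrite -big_filter; apply: perm_big; apply: uniq_perm => //.
  exact: filter_uniq.
by move=> i; rewrite mem_filter andb_idr //; exact: ts.
Qed.

(** Choose a finite [s] whose sum of norms is within e / 2 of the supremum, then [N] such that [L N]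
    contains [s] and sums to within e / 2 of [l]. Any finite set containing [L N] adds terms of
    total norm less than e / 2. *)
Lemma cvg_partial_sum (I : choiceType) (f : I -> C) (L : nat -> seq I) (B l : C) :
  (forall N, uniq (L N)) ->
  (forall i, \forall N \near \oo, i \in L N) ->
  (forall N, \sum_(i <- L N) `|f i| <= B) ->
  (fun N => \sum_(i <- L N) f i) @ \oo --> l ->
  partial_sum f @ totally --> l.
Proof.
move=> uL exhL leB cvgL.
pose g i := @complex.Re R `|f i|.
have gE i : (g i)%:C = `|f i| by rewrite RRe_real // normr_real.
have g0 i : 0 <= g i by rewrite -ler0c gE.
have subL (s : seq I) : \forall N \near \oo, {subset s <= L N}.
  elim: s => [|i s IH]; first by exists 0.
  apply: filterS2 IH (exhL i) => N sN iN j; rewrite inE => /predU1P[->//|]; exact: sN.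
have mono (s t : seq I) : uniq s -> uniq t -> {subset t <= s} ->
    \sum_(i <- t) g i <= \sum_(i <- s) g i.
  by move=> us ut ts; rewrite (sum_subset_uniq g us ut ts) lerDl sumr_ge0.
have B0 : 0 <= B by apply: le_trans (leB 0); apply: sumr_ge0.
have [b _ hb] := ge0_complexP B0.
pose E := [set x | exists2 s : seq I, uniq s & x = \sum_(i <- s) g i].
have supE : has_sup E.
  split; first by exists 0, [::]; rewrite ?big_nil.
  exists b => _ [s us ->]; have [N _ /(_ N (leqnn N)) sN] := subL s.
  apply: (le_trans (mono _ _ (uL N) us sN)); rewrite -lecR rmorph_sum -hb.
  by rewrite (eq_bigr (fun i => `|f i|)) // => i _; exact: gE.
have TF : ProperFilter (@totally I) := totally_filter.
apply/cvgrPdist_lt => e e0.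
have [e' _ he] := ge0_complexP (ltW e0).
move: e0; rewrite he -[0]/(0%:C) ltcR => e0.
have e20 : 0 < e' / 2 by rewrite divr_gt0.
have [_ [s us ->] hs] := sup_adherent e20 supE.
have e20C : (0 : C) < (e' / 2)%:C by rewrite -[0]/(0%:C) ltcR.
move/cvgrPdist_lt/(_ _ e20C): cvgL => cvgL.
have [N _ /(_ N (leqnn N)) [sN lN]] := filterI (subL s) cvgL.
exists [fset i in L N]%fset => // A /= /fsubsetP NA.
have {}NA : {subset L N <= A} by move=> i iN; apply: NA; rewrite inE.
have -> : partial_sum f A = \sum_(i <- enum_fset A) f i.
  by rewrite /partial_sum big_seq_fsetE.
rewrite (sum_subset_uniq f (fset_uniq A) (uL N) NA) opprD addrA.
apply: (le_lt_trans (ler_normB _ _)).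
rewrite [e']splitr rmorphD ltr_leD //.
apply: (le_trans (ler_norm_sum _ _ _)).
rewrite (eq_bigr (fun i => (g i)%:C)) => [|i _]; last by rewrite gE.
rewrite -(rmorph_sum (real_complex R)) lecR.
have := sum_subset_uniq g (fset_uniq A) (uL N) NA.
have /= hA : \sum_(i <- A) g i <= sup E.
  by apply: ub_le_sup; [exact: supE.2 | exists (enum_fset A)].
have := mono _ _ (uL N) us sN.
lra.
Qed.

End UnorderedSum.

(** * Infinite q-Pochhammer symbols *)

Section QPochhammerLimits.
Variable R : realType.
Local Notation C := (R[i] : numFieldType).
Implicit Types a q : C.

Lemma ler_normM_le (x y b c : C) : `|x| <= b -> `|y| <= c -> `|x * y| <= b * c.
Proof. by move=> xb yc; rewrite normrM ler_pM. Qed.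

Lemma cvgn_reindex (u : nat -> C) (l : C) (phi : nat -> nat) :
  (forall m, \forall n \near \oo, (m <= phi n)%N) ->
  u @ \oo --> l -> (fun n => u (phi n)) @ \oo --> l.
Proof.
move=> hphi hu; apply: (cvg_comp _ _ _ hu) => A [m _ hm].
by apply: filterS (hphi m) => n /hm.
Qed.

Lemma qpoch_bounded a q : `|q| < 1 ->
  exists2 B, 0 < B & forall n, `|qpoch a q n| <= B.
Proof.
move=> q1; have [B B0 hB] := prod_1Dgeom_bounded (normr_ge0 a) (normr_ge0 q) q1.
exists B => // n; apply: le_trans (hB n); rewrite normr_prod.
apply: ler_prod => i _; rewrite normr_ge0 (le_trans (ler_normB _ _)) //.
by rewrite normr1 normrM normrX.
Qed.

(** Successive differences are -a q^n (a; q)_n, which are geometrically small since the partial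
    products are bounded. *)
Lemma cvg_qpoch a q : `|q| < 1 -> qpoch a q @ \oo --> qpoch_inf a q.
Proof.
move=> q1; have [B B0 hB] := qpoch_bounded a q1.
suff : cvgn (series (telescope (qpoch a q))).
  rewrite telescopeK => h.
  apply/cvg_ex; move/cvg_ex: h => [l hl]; exists (l + 1).
  have -> : qpoch a q = (fun n => (qpoch a q n - qpoch a q 0) + 1).
    by apply/funext => n; rewrite qpoch0 subrK.
  by apply: cvgD; [exact: hl | exact: cvg_cst].
apply: (@cvg_series_geom _ _ (B * `|a|) q) => // n.
rewrite /telescope /= qpochS mulrBr mulr1 addrAC subrr sub0r normrN -mulrA.
by rewrite -normrX -normrM; apply: ler_normM_le.
Qed.

Lemma sub1_exp_neq0 a : `|a| < 1 -> 1 - a != 0.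
Proof. by move=> a1; rewrite subr_eq0; apply: contraTneq a1 => <-; rewrite normr1 ltxx. Qed.

Lemma qpoch_neq0 a q n : `|a| < 1 -> `|q| < 1 -> qpoch a q n != 0.
Proof.
move=> a1 q1; apply/prodf_neq0 => i _; apply: sub1_exp_neq0.
rewrite normrM normrX (le_lt_trans _ a1) // ler_piMr //.
by rewrite exprn_ile1 // ltW.
Qed.

Lemma inv_qpoch_bounded a q : `|a| < 1 -> `|q| < 1 ->
  exists2 B, 0 < B & forall n, `|(qpoch a q n)^-1| <= B.
Proof.
move=> a1 q1; have a10 : 0 < 1 - `|a| by rewrite subr_gt0.
(* With x = a q^i, the bound 1 / (1 - |x|) = 1 + |x| / (1 - |x|) is at most 1 + |a| |q|^i / (1 -
   |a|). *)
have c0 : 0 <= `|a| / (1 - `|a|) by rewrite divr_ge0 // ltW.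
have [B B0 hB] := prod_1Dgeom_bounded c0 (normr_ge0 q) q1.
exists B => // n; apply: le_trans (hB n).
rewrite /qpoch -prodfV normr_prod; apply: ler_prod => i _; rewrite normr_ge0 /=.
set x := a * q ^+ i.
have xE : `|x| = `|a| * `|q| ^+ i by rewrite normrM normrX.
have xa : `|x| <= `|a| by rewrite xE ler_piMr // exprn_ile1 // ltW.
have x10 : 0 < 1 - `|x| by rewrite subr_gt0 (le_lt_trans xa).
rewrite normfV mulrAC -xE.
apply: (@le_trans _ _ (1 - `|x|)^-1).
  rewrite lef_pV2 ?posrE //; last by rewrite normr_gt0 sub1_exp_neq0 // -subr_gt0.
  by have := lerB_dist 1 x; rewrite normr1.
rewrite -[X in X <= _](_ : 1 + `|x| / (1 - `|x|) = _); last first.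
  by field; rewrite gt_eqF.
by rewrite lerD2l ler_wpM2l // lef_pV2 ?posrE // lerD2l lerN2.
Qed.

(** A limit 0 would make the inverses of the partial products unbounded. *)
Lemma qpoch_inf_neq0 a q : `|a| < 1 -> `|q| < 1 -> qpoch_inf a q != 0.
Proof.
move=> a1 q1; have [B B0 hB] := inv_qpoch_bounded a1 q1.
apply/eqP => P0; have := @cvg_qpoch a q q1; rewrite P0.
have iB0 : 0 < B^-1 by rewrite invr_gt0.
move=> /cvgr0Pnorm_lt/(_ _ iB0)[n _ /(_ n (leqnn n))].
rewrite -ltf_pV2 ?posrE // ?normr_gt0 ?qpoch_neq0 // invrK -normfV => h.
by have := lt_le_trans h (hB n); rewrite ltxx.
Qed.

Lemma qpoch_inf_dissect3 a q : `|q| < 1 ->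
  qpoch_inf a q = qpoch_inf a (q ^+ 3) * qpoch_inf (a * q) (q ^+ 3)
    * qpoch_inf (a * q ^+ 2) (q ^+ 3).
Proof.
move=> q1; have q31 : `|q ^+ 3| < 1 by rewrite normrX exprn_ilt1.
apply: (@cvg_unique _ _ ((fun n => qpoch a q (3 * n)) @ \oo)) => //.
  apply: cvgn_reindex; last exact: cvg_qpoch.
  by move=> m; exists m => // n /= hn; lia.
have -> : (fun n => qpoch a q (3 * n)) = (fun n => qpoch a (q ^+ 3) n
    * qpoch (a * q) (q ^+ 3) n * qpoch (a * q ^+ 2) (q ^+ 3) n).
  by apply/funext => n; exact: qpoch_dissect3.
by apply: cvgM; [apply: cvgM|]; exact: cvg_qpoch.
Qed.

Lemma qpoch_inf_sqr a q : `|q| < 1 ->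
  qpoch_inf (a ^+ 2) (q ^+ 2) = qpoch_inf a q * qpoch_inf (- a) q.
Proof.
move=> q1; have q21 : `|q ^+ 2| < 1 by rewrite normrX exprn_ilt1.
apply: (@cvg_unique _ _ (qpoch (a ^+ 2) (q ^+ 2) @ \oo)) => //; first exact: cvg_qpoch.
have -> : qpoch (a ^+ 2) (q ^+ 2) = (fun n => qpoch a q n * qpoch (- a) q n).
  by apply/funext => n; exact: qpoch_sqr.
by apply: cvgM; exact: cvg_qpoch.
Qed.

End QPochhammerLimits.

(** * Truncated generating function and final quotient *)

Section Identities.

(** Each first factor is -q^(2i+1) (1 - q^(2i+1)); together they give (-1)^n q^(n^2) (q; q^2)_n.
    Bounding k by [N] truncates the geometric series, whence the correction product. *)
Lemma words_weight_series_term (K : numFieldType) (q : K) N n :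
  (forall m, 1 - (q ^+ 4) ^+ m.+1 != 0) ->
  \prod_(i < n) ((-1 * q ^+ (2 * i).+1 + q ^+ (2 * (2 * i).+1))
    * \sum_(k < N) q ^+ (4 * i.+1 * k)) =
  series_term q n * \prod_(i < n) (1 - q ^+ (4 * i.+1 * N)).
Proof.
move=> q4_free; elim: n => [|n IH]; first by rewrite !big_ord0 /series_term !qpoch0 !expr0 invr1 !mulr1.
rewrite !big_ord_recr /= IH /series_term.
set y := q ^+ (4 * n.+1).
have y10 : 1 - y != 0 by rewrite /y exprM.
have -> : \sum_(k < N) q ^+ (4 * n.+1 * k) = (1 - y ^+ N) / (1 - y).
  apply: (canRL (mulfK y10)); rewrite mulrC -[1 - y]opprB mulNr.
  rewrite (eq_bigr (fun k : 'I_N => y ^+ k)) => [|k _]; last by rewrite exprM.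
  by rewrite -subrX1 opprB.
rewrite [q ^+ (4 * n.+1 * N)]exprM -/y.
rewrite qpochS qfactS -exprM -[q * q ^+ (2 * n)]exprS -[(q ^+ 4) ^+ n.+1]exprM -/y.
rewrite (_ : n.+1 ^ 2 = n ^ 2 + (2 * n).+1)%N; last lia.
rewrite exprD [(2 * (2 * n).+1)%N]mulnC [q ^+ ((2 * n).+1 * 2)]exprM.
rewrite [(-1) ^+ n.+1]exprS.
by field; rewrite y10 qfact_neq0.
Qed.

(** In base q^6, [a], [b], [c], [d], [e], [p], [t] stand for the symbols at q, q^3, q^5, q^2, q^4,
    q^6, -q^3; then b t = (q^6; q^12). *)
Lemma slater_quotient (F : fieldType) (a b c d e p t : F) :
  b != 0 -> d != 0 -> e != 0 -> p != 0 ->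
  a * b * c * (t ^+ 2 * p) / (d * e * p) = (a * c * (b * t) ^+ 2) / (d * b * e).
Proof. by move=> b0 d0 e0 p0; field; rewrite b0 d0 e0 p0. Qed.

End Identities.

(** * The series as an infinite product *)

Section Slater.
Variable R : realType.
Local Notation C := (R[i] : numFieldType).
Variable q : C.
Hypothesis q1 : `|q| < 1.

Let norm_expr_lt1 n : `|q ^+ n.+1| < 1.
Proof. by rewrite normrX exprn_ilt1. Qed.

Let expr_free m n : 1 - (q ^+ m.+1) ^+ n.+1 != 0.
Proof. by rewrite -exprM sub1_exp_neq0 // mulnS addSn. Qed.

Lemma norm_expr_le m n : (n <= m)%N -> `|q ^+ m| <= `|q| ^+ n.
Proof. by move=> nm; rewrite normrX ler_wiXn2l // ltW. Qed.

Lemma series_term_bound : exists M, forall n, `|series_term q n| <= M * `|q| ^+ n.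
Proof.
have [B1 _ hB1] := qpoch_bounded q (norm_expr_lt1 1).
have [B2 _ hB2] := inv_qpoch_bounded (norm_expr_lt1 3) (norm_expr_lt1 3).
exists (B1 * B2) => n; rewrite /series_term mulrAC.
apply: ler_normM_le; last by apply: norm_expr_le; nia.
by apply: ler_normM_le => //; rewrite normrM normrX normrN normr1 expr1n mulr1.
Qed.

Lemma cvg_series_term : cvgn (series (series_term q)).
Proof. by have [M hM] := series_term_bound; exact: cvg_series_geom q1 hM. Qed.

Let theta_term r : C := fold_weight C r * q ^+ (3 * r ^ 2).

Lemma theta_term_bound r : `|theta_term r| <= 2 * `|q| ^+ r.
Proof.
apply: ler_normM_le; last by apply: norm_expr_le; nia.
by case: r => [|r]; rewrite /= ?normr1 ?normr_nat // ler1n.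
Qed.

Lemma cvg_theta : cvgn (series theta_term).
Proof. exact: cvg_series_geom q1 theta_term_bound. Qed.

Lemma cvg_series_mulr (u : nat -> C) (c : C) : cvgn (series u) ->
  series (fun n => u n * c) @ \oo --> limn (series u) * c.
Proof.
move=> hu; have -> : series (fun n => u n * c) = (fun n => series u n * c).
  by apply/funext => n; rewrite /series /= mulr_suml.
exact: cvgMr_tmp.
Qed.

Lemma near_leq_subn m r : \forall n \near \oo, (m <= n - r)%N.
Proof. by exists (m + r)%N => // n /= hn; lia. Qed.

Lemma near_leq_addn m r : \forall n \near \oo, (m <= n + r)%N.
Proof. by exists m => // n /= hn; lia. Qed.

(** [theta_finite] at q^3 in the limit: for each [r] the quotient of q-factorials tends to 1 / (q^6;
    q^6). *)
Lemma theta_product : limn (series theta_term) =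
  qpoch_inf (- q ^+ 3) (q ^+ 6) ^+ 2 * qpoch_inf (q ^+ 6) (q ^+ 6).
Proof.
have q61 := norm_expr_lt1 5.
pose P := qpoch (q ^+ 6) (q ^+ 6); pose Pinf := qpoch_inf (q ^+ 6) (q ^+ 6).
have P0 : Pinf != 0 by exact: qpoch_inf_neq0.
have [B _ hB] := qpoch_bounded (q ^+ 6) q61.
have [B' _ hB'] := inv_qpoch_bounded q61 q61.
apply: (canRL (divfK P0)).
apply: (@cvg_unique _ _ ((fun N => qpoch (- q ^+ 3) (q ^+ 6) N ^+ 2) @ \oo)) => //.
  have -> : (fun N => qpoch (- q ^+ 3) (q ^+ 6) N ^+ 2) =
     (fun N => \sum_(r < N.+1) theta_term r * (P (2 * N)%N * ((P (N - r)%N)^-1 * (P (N + r)%N)^-1))).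
    apply/funext => N; have e : (q ^+ 3) ^+ 2 = q ^+ 6 by rewrite -exprM.
    have := @theta_finite _ (q ^+ 3) N; rewrite e => /(_ (expr_free 5)) <-.
    by apply: eq_bigr => r _; rewrite /theta_term -exprM mulrA invfM.
  apply: (@tannery _
      (fun N r => theta_term r * (P (2 * N)%N * ((P (N - r)%N)^-1 * (P (N + r)%N)^-1)))
      (fun r => theta_term r * Pinf^-1)
      (2 * (B * (B' * B'))) q _ q1).
  - move=> N r; rewrite [leRHS]mulrAC; apply: ler_normM_le; first exact: theta_term_bound.
    by apply: ler_normM_le => //; exact: ler_normM_le.
  - move=> r; apply: cvgMl_tmp.
    have : (fun N => P (2 * N)%N * ((P (N - r)%N)^-1 * (P (N + r)%N)^-1)) @ \oo -->
        Pinf * (Pinf^-1 * Pinf^-1).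
      apply: cvgM; last apply: cvgM.
      + by apply: cvgn_reindex; [move=> m; exists m => // n /= hn; lia | exact: cvg_qpoch].
      + by apply: cvgV => //; apply: cvgn_reindex (near_leq_subn ^~ r) _; exact: cvg_qpoch.
      + by apply: cvgV => //; apply: cvgn_reindex (near_leq_addn ^~ r) _; exact: cvg_qpoch.
    by rewrite mulVKf.
  - exact: cvg_series_mulr cvg_theta.
by apply: cvgM; exact: cvg_qpoch.
Qed.

Lemma slater_theta : limn (series (series_term q)) =
  qpoch_inf q (q ^+ 2) * limn (series theta_term) / qpoch_inf (q ^+ 2) (q ^+ 2).
Proof.
have q21 := norm_expr_lt1 1.
pose P := qpoch (q ^+ 2) (q ^+ 2); pose Pinf := qpoch_inf (q ^+ 2) (q ^+ 2).
have P0 : Pinf != 0 by exact: qpoch_inf_neq0.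
have [B _ hB] := inv_qpoch_bounded q21 q21.
have [M hM] := series_term_bound.
have cvP r : (fun N => (P (N - r)%N)^-1) @ \oo --> Pinf^-1.
  by apply: cvgV => //; apply: cvgn_reindex (near_leq_subn ^~ r) _; exact: cvg_qpoch.
have cvP' r : (fun N => (P (N + r)%N)^-1) @ \oo --> Pinf^-1.
  by apply: cvgV => //; apply: cvgn_reindex (near_leq_addn ^~ r) _; exact: cvg_qpoch.
have iP0 : Pinf^-1 != 0 by rewrite invr_eq0.
(* In the limit [bailey_finite] carries one factor [Pinf^-1] on the left and two on the right. *)
apply: (mulIf iP0); rewrite -!mulrA.
apply: (@cvg_unique _ _
  ((fun N => \sum_(n < N.+1) series_term q n * (P (N - n)%N)^-1) @ \oo)) => //.
  apply: (@tannery _ (fun N n => series_term q n * (P (N - n)%N)^-1)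
    (fun n => series_term q n * Pinf^-1) (M * B) q _ q1).
  - by move=> N n; rewrite [leRHS]mulrAC; exact: ler_normM_le.
  - by move=> n; apply: cvgMl_tmp; exact: cvP.
  - exact: cvg_series_mulr cvg_series_term.
have -> : (fun N => \sum_(n < N.+1) series_term q n * (P (N - n)%N)^-1) =
  (fun N => qpoch q (q ^+ 2) N *
     \sum_(r < N.+1) theta_term r * ((P (N - r)%N)^-1 * (P (N + r)%N)^-1)).
  apply/funext => N; rewrite (bailey_finite N (expr_free 1)); congr (_ * _).
  by apply: eq_bigr => r _; rewrite /theta_term -mulrA invfM.
apply: cvgM; first exact: cvg_qpoch.
apply: (@tannery _ (fun N r => theta_term r * ((P (N - r)%N)^-1 * (P (N + r)%N)^-1))
  (fun r => theta_term r * (Pinf^-1 * Pinf^-1)) (2 * (B * B)) q _ q1).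
- move=> N r; rewrite [leRHS]mulrAC; apply: ler_normM_le; first exact: theta_term_bound.
  exact: ler_normM_le.
- by move=> r; apply: cvgMl_tmp; apply: cvgM; [exact: cvP | exact: cvP'].
- exact: cvg_series_mulr cvg_theta.
Qed.

Lemma slater_product : limn (series (series_term q)) =
  (qpoch_inf q (q ^+ 6) * qpoch_inf (q ^+ 5) (q ^+ 6)
     * qpoch_inf (q ^+ 6) (q ^+ 12) ^+ 2)
  / (qpoch_inf (q ^+ 2) (q ^+ 6) * qpoch_inf (q ^+ 3) (q ^+ 6)
     * qpoch_inf (q ^+ 4) (q ^+ 6)).
Proof.
have q21 := norm_expr_lt1 1; have q61 := norm_expr_lt1 5.
have e23 : (q ^+ 2) ^+ 3 = q ^+ 6 by rewrite -exprM.
have e22 : (q ^+ 2) ^+ 2 = q ^+ 4 by rewrite -exprM.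
have e32 : (q ^+ 3) ^+ 2 = q ^+ 6 by rewrite -exprM.
have e62 : (q ^+ 6) ^+ 2 = q ^+ 12 by rewrite -exprM.
have := qpoch_inf_dissect3 q q21; rewrite e23 e22 -!exprS => dissect1.
have := qpoch_inf_dissect3 (q ^+ 2) q21; rewrite e23 e22 -!exprD => dissect2.
have := qpoch_inf_sqr (q ^+ 3) q61; rewrite e32 e62 => sqr6.
rewrite slater_theta theta_product dissect1 dissect2 sqr6.
by apply: slater_quotient; apply: qpoch_inf_neq0; exact: norm_expr_lt1.
Qed.

Let x : C := `|q|.
Let x0 : 0 <= x. Proof. exact: normr_ge0. Qed.

(** Each factor is at most x (1 + x^i) (1 + x^i / (1 - x)), and the last two have bounded products.
    The bound is uniform in [N]; it serves both absolute summability and [tannery]. *)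
Lemma words_weight_bound : exists M, forall N n,
  \prod_(i < n) ((1 * x ^+ (2 * i).+1 + x ^+ (2 * (2 * i).+1))
    * \sum_(k < N) x ^+ (4 * i.+1 * k)) <= M * x ^+ n.
Proof.
have x10 : 0 < 1 - x by rewrite subr_gt0.
have c0 : 0 <= (1 - x)^-1 by rewrite invr_ge0 ltW.
have [B1 B10 hB1] := prod_1Dgeom_bounded ler01 x0 q1.
have [B2 B20 hB2] := prod_1Dgeom_bounded c0 x0 q1.
exists (B1 * B2) => N n.
apply: (@le_trans _ _ (\prod_(i < n) ((1 + 1 * x ^+ i) * (1 + (1 - x)^-1 * x ^+ i) * x))).
  apply: ler_prod => i _; apply/andP; split.
    by rewrite mulr_ge0 ?addr_ge0 ?sumr_ge0 ?mul1r ?exprn_ge0 // => k _; rewrite exprn_ge0.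
  rewrite !mul1r mulrAC; apply: ler_pM.
  - by rewrite addr_ge0 ?exprn_ge0.
  - by apply: sumr_ge0 => k _; rewrite exprn_ge0.
  - rewrite mulrDl mul1r; apply: lerD.
      by rewrite -[leRHS]expr1 ler_wiXn2l // ltW.
    by rewrite -exprSr; apply: ler_wiXn2l; [exact: x0 | exact: ltW | lia].
  set y := x ^+ (4 * i.+1).
  have y0 : 0 <= y by rewrite exprn_ge0.
  have yx : y <= x by rewrite -[leRHS]expr1 /y ler_wiXn2l // ltW.
  have y1 : y < 1 by exact: le_lt_trans yx q1.
  have y10 : 0 < 1 - y by rewrite subr_gt0.
  rewrite (eq_bigr (fun k : 'I_N => y ^+ k)) => [|k _]; last by rewrite exprM.
  apply: (@le_trans _ _ (1 - y)^-1).
    have := geom_sum_le y0 y1 (leq0n N).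
    by rewrite big_mkord expr0 mul1r.
  rewrite -[X in X <= _](_ : 1 + (1 - y)^-1 * y = _); last by field; rewrite gt_eqF.
  rewrite lerD2l ler_pM ?invr_ge0 ?(ltW y10) //.
    by rewrite lef_pV2 ?posrE // lerD2l lerN2.
  by apply: ler_wiXn2l; [exact: x0 | exact: ltW | lia].
rewrite !big_split /= prodr_const card_ord ler_wpM2r ?exprn_ge0 //.
apply: ler_pM; [| |exact: hB1|exact: hB2]; apply: prodr_ge0 => i _;
  by rewrite addr_ge0 ?mulr_ge0 ?exprn_ge0.
Qed.

End Slater.

(** * Finite boxes exhausting P_4 *)

Definition P4_word (t : seq (bool * nat)) : {s : seq nat | P4 s} :=
  exist _ (P4_of_word t) (P4_of_wordP t).

Definition P4_box (N : nat) : seq {s : seq nat | P4 s} :=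
  [seq P4_word t | t <- flatten [seq words N n | n <- iota 0 N.+1]].

Lemma P4_box_uniq N : uniq (P4_box N).
Proof.
rewrite map_inj_uniq => [|t u [] /P4_of_word_inj //].
elim: N.+1 => // m IH; rewrite -addn1 iotaD map_cat flatten_cat cat_uniq IH /= cats0.
rewrite words_uniq andbT; apply/hasPn => t; rewrite mem_words => /andP[/eqP tm _].
apply/flattenP => -[_ /mapP[n +  ->]]; rewrite mem_iota mem_words add0n => /andP[_ nm].
by move=> /andP[/eqP e _]; lia.
Qed.

Lemma P4_box_exhaustive i : \forall N \near \oo, i \in P4_box N.
Proof.
case: i => s hs; have [t ht] := P4_of_word_surj hs.
(* [N] must be at least the length and strictly exceed every [k] of the word. *)
exists (maxn (size t) (\max_(x <- t) x.2).+1) => // N /= hN.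
apply/mapP; exists t; last by apply: val_inj.
apply/flattenP; exists (words N (size t)).
  by apply/mapP; exists (size t) => //; rewrite mem_iota; lia.
rewrite mem_words eqxx /=; apply/allP => x xt.
move: hN; rewrite geq_max => /andP[_]; apply: leq_trans; rewrite ltnS.
exact: (@leq_bigmax_seq _ t xpredT (fun x : bool * nat => x.2) x xt isT).
Qed.

Lemma sum_P4_box (K : numFieldType) (s q : K) N :
  \sum_(i <- P4_box N) s ^+ odd_parts (val i) * q ^+ sumn (val i) =
  \sum_(n < N.+1) \prod_(i < n) ((s * q ^+ (2 * i).+1 + q ^+ (2 * (2 * i).+1))
     * \sum_(k < N) q ^+ (4 * i.+1 * k)).
Proof.
rewrite /P4_box big_map big_flatten big_map.
rewrite -[N.+1 in LHS]subn0 -/(index_iota 0 N.+1) big_mkord.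
apply: eq_bigr => n _; rewrite -(sum_words s q N n 0).
by apply: eq_bigr => t _; rewrite word_weight0.
Qed.

(** * Summation over P_4 *)

Section P4Sum.
Variable R : realType.
Local Notation C := (R[i] : numFieldType).
Variable q : C.
Hypothesis q1 : `|q| < 1.

Lemma P4_term_abs_bounded : exists B, forall N,
  \sum_(i <- P4_box N) `|P4_term q i| <= B.
Proof.
have [M hM] := words_weight_bound q1.
have M0 : 0 <= M by have := hM 0 0; rewrite big_ord0 expr0 mulr1; exact: le_trans ler01.
exists (M * (`|q| ^+ 0 / (1 - `|q|))) => N.
rewrite (eq_bigr (fun i => 1 ^+ odd_parts (val i) * `|q| ^+ sumn (val i))); last first.
  by move=> i _; rewrite /P4_term normrM !normrX normrN normr1.
rewrite sum_P4_box; apply: (@le_trans _ _ (\sum_(n < N.+1) M * `|q| ^+ n)).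
  by apply: ler_sum => n _; exact: hM.
rewrite -mulr_sumr ler_wpM2l // -(big_mkord xpredT (fun n => `|q| ^+ n)).
exact: geom_sum_le.
Qed.

Lemma cvg_expr0 : GRing.exp q @ \oo --> (0 : C).
Proof.
apply/cvgr0Pnorm_lt => e e0; have /cvgr0Pnorm_lt/(_ e e0) := cvg_norm_exp q1.
by apply: filterS => n; rewrite -normrX normr_id.
Qed.

Let q4_free m : 1 - (q ^+ 4) ^+ m.+1 != 0.
Proof. by rewrite -exprM sub1_exp_neq0 // normrX exprn_ilt1. Qed.

Lemma cvg_P4_box :
  (fun N => \sum_(i <- P4_box N) P4_term q i) @ \oo --> limn (series (series_term q)).
Proof.
have [M hM] := words_weight_bound q1.
have -> : (fun N => \sum_(i <- P4_box N) P4_term q i) =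
    (fun N => \sum_(n < N.+1) series_term q n * \prod_(i < n) (1 - q ^+ (4 * i.+1 * N))).
  apply/funext => N; rewrite sum_P4_box; apply: eq_bigr => n _.
  by apply: words_weight_series_term; exact: q4_free.
apply: (@tannery _
    (fun N n => series_term q n * \prod_(i < n) (1 - q ^+ (4 * i.+1 * N)))
    (series_term q) M q _ q1).
(* Back in the form of a product over letters, the term is dominated by the same product at |q| with
   s = 1. *)
- move=> N n; apply: le_trans (hM N n); rewrite -words_weight_series_term; last exact: q4_free.
  rewrite normr_prod.
  apply: ler_prod => i _; rewrite normr_ge0 normrM ler_pM //.
    by rewrite (le_trans (ler_normD _ _)) // normrM !normrX normrN normr1.
  apply: (le_trans (ler_norm_sum _ _ _)); apply: ler_sum => k _.
  by rewrite normrX.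
- move=> n; rewrite -[X in _ --> X]mulr1; apply: cvgMl_tmp.
  elim: n => [|n IH].
    have -> : (fun N => \prod_(i < 0) (1 - q ^+ (4 * i.+1 * N))) = (fun=> 1 : C).
      by apply/funext => N; rewrite big_ord0.
    exact: cvg_cst.
  have -> : (fun N => \prod_(i < n.+1) (1 - q ^+ (4 * i.+1 * N))) =
      (fun N => \prod_(i < n) (1 - q ^+ (4 * i.+1 * N)) * (1 - q ^+ (4 * n.+1 * N))).
    by apply/funext => N; rewrite big_ord_recr.
  rewrite -[X in _ --> X]mulr1; apply: cvgM => //.
  rewrite -[X in _ --> X]subr0; apply: cvgB; first exact: cvg_cst.
  apply: (@cvgn_reindex _ (GRing.exp q) _ (fun N => 4 * n.+1 * N)%N) cvg_expr0.
  by move=> m; exists m => // N /= hN; nia.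
- exact: cvg_series_term.
Qed.

End P4Sum.

(** Convergence is stated beside the equalities because [sum] and [limn] take a value even without
    it. *)
Theorem theorem3p7 (R : realType) (q : (R[i] : numFieldType)) (hq : `|q| < 1) :
  [/\ cvg (partial_sum (P4_term q) @ totally),
      cvgn (series (series_term q)),
      sum (P4_term q) = limn (series (series_term q))
    & limn (series (series_term q)) =
      (qpoch_inf q (q ^+ 6) * qpoch_inf (q ^+ 5) (q ^+ 6)
         * qpoch_inf (q ^+ 6) (q ^+ 12) ^+ 2)
      / (qpoch_inf (q ^+ 2) (q ^+ 6) * qpoch_inf (q ^+ 3) (q ^+ 6)
         * qpoch_inf (q ^+ 4) (q ^+ 6))].
Proof.
have [B hB] := P4_term_abs_bounded hq.
have hP4 : partial_sum (P4_term q) @ totally --> limn (series (series_term q)).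
  exact: cvg_partial_sum P4_box_uniq P4_box_exhaustive hB (cvg_P4_box hq).
have TF : ProperFilter (@totally {s : seq nat | P4 s}) := totally_filter.
split; [by apply: cvgP hP4 | exact: cvg_series_term | exact: cvg_lim hP4
  | exact: slater_product].
Qed.
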